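(* Assume there exists a measurable cardinal and let $\mu=\mu_{\mathrm{first}}$ be the least measurable cardinal. Then there is a reflexive abelian group $G\subseteq {}^{\mu}\mathbb{Z}$ (a subgroup of the full product $\prod_{\alpha<\mu}\mathbb{Z}$) with $|G|=\mu$.
   Context: A cardinal $\mu$ is measurable if it is uncountable and there is a non-principal $\mu$-complete ultrafilter on $\mu$. For an abelian group $G$, its dual is $G^*=\mathrm{Hom}(G,\mathbb{Z})$ and its double dual is $G^{**}=\mathrm{Hom}(G^*,\mathbb{Z})$. The canonical homomorphism $G\to G^{**}$ sends $a\in G$ to $F_a$, where $F_a(f)=f(a)$ for $f\in G^*$. $G$ is called reflexive if this canonical homomorphism is an isomorphism. *)

(* Defs.v *)
From HB Require Import structures.
From mathcomp Require Import all_boot all_order all_algebra.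
From mathcomp Require Import all_classical.

Set Implicit Arguments.
Unset Strict Implicit.
Unset Printing Implicit Defensive.

Import GRing.Theory.

Local Open Scope classical_set_scope.
Local Open Scope card_scope.
Local Open Scope ring_scope.

(* A cardinal is represented by a type of that cardinality: all the notions
   below are invariant under bijections of the type. *)

Definition card_lt T U (A : set T) (B : set U) : Prop :=
  A #<= B /\ ~ (B #<= A).

(* Closure under intersections of fewer than #|M| members. *)
Definition card_complete (M : Type) (F : set_system M) : Prop :=
  forall S : set (set M), S `<=` F -> card_lt S [set: M] ->
    F (\bigcap_(A in S) A).

Definition measurable_cardinal (M : Type) : Prop :=
  ~ countable [set: M] /\
  exists F : set_system M,
    [/\ UltraFilter F,
        forall x : M, F <> principal_filter x
      & card_complete F].

Definition first_measurable_cardinal (M : Type) : Prop :=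
  measurable_cardinal M /\
  forall K : Type, measurable_cardinal K -> [set: M] #<= [set: K].

Definition dual (G : zmodType) : Type := {additive G -> int}.

Section DualZmodule.
Variable G : zmodType.

HB.instance Definition _ := gen_eqMixin (dual G).
HB.instance Definition _ := gen_choiceMixin (dual G).

Lemma dual_ext (f g : dual G) : (forall a, f a = g a) -> f = g.
Proof.
case: f g => [f [[pf]]] [g [[pg]]] /= /funext fg; move: pf pg; rewrite fg.
by move=> pf pg; rewrite (Prop_irrelevance pf pg).
Qed.

Definition dual_zero : dual G := (\0 : G -> int)%R.
Definition dual_opp (f : dual G) : dual G := (\- f)%R.
Definition dual_add (f g : dual G) : dual G := (f \+ g)%R.

Fact dual_addA : associative dual_add.
Proof. by move=> f g h; apply: dual_ext => a /=; rewrite addrA. Qed.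

Fact dual_addC : commutative dual_add.
Proof. by move=> f g; apply: dual_ext => a /=; rewrite addrC. Qed.

Fact dual_add0 : left_id dual_zero dual_add.
Proof. by move=> f; apply: dual_ext => a /=; rewrite add0r. Qed.

Fact dual_addN : left_inverse dual_zero dual_opp dual_add.
Proof. by move=> f; apply: dual_ext => a /=; rewrite addNr. Qed.

HB.instance Definition _ :=
  GRing.isZmodule.Build (dual G) dual_addA dual_addC dual_add0 dual_addN.

End DualZmodule.

Section Evaluation.
Variable G : zmodType.

Definition dual_eval (a : G) (f : dual G) : int := f a.

Fact dual_eval_zmod_morphism (a : G) : zmod_morphism (dual_eval a).
Proof. by []. Qed.

HB.instance Definition _ (a : G) :=
  GRing.isZmodMorphism.Build (dual G) int (dual_eval a)
    (dual_eval_zmod_morphism a).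

Definition double_dual_map (a : G) : dual (dual G) := dual_eval a.

Fact double_dual_map_zmod_morphism : zmod_morphism double_dual_map.
Proof. by move=> a b; apply: dual_ext => f; exact: raddfB. Qed.

HB.instance Definition _ :=
  GRing.isZmodMorphism.Build G (dual (dual G)) double_dual_map
    double_dual_map_zmod_morphism.

End Evaluation.

(* [double_dual_map] being additive, it is an isomorphism iff it is bijective. *)
Definition reflexive_group (G : zmodType) : Prop :=
  bijective (@double_dual_map G).

Definition subgroup_type (V : zmodType) (G : zmodClosed V) : Type :=
  {x : V | x \in G}.

HB.instance Definition _ (V : zmodType) (G : zmodClosed V) :=
  SubChoice.on (subgroup_type G).
HB.instance Definition _ (V : zmodType) (G : zmodClosed V) :=
  [SubChoice_isSubZmodule of subgroup_type G by <:].

(* Main.v *)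
Require Import Defs.
From HB Require Import structures.
From mathcomp Require Import all_boot all_order all_algebra.
From mathcomp Require Import finmap all_classical.
From mathcomp Require Import zify.
From mathcomp Require wochoice.

(** Let mu be the first measurable cardinal.  For a family J of subsets of mu,
    let J^perp be the family of sets meeting every member of J in a finite set,
    and G_J the group of functions mu -> Z with support in J^perp.  By the
    theorem of Los, a homomorphism Z^A -> Z with |A| < mu is a finite linear
    combination of coordinates; so if all members of J^perp have cardinality
    less than mu, the pairing (f, g) |-> sum_x f x * g x identifies the dual of
    G_J with G_(J^perp).  Since J^perp^perp^perp = J^perp, the group G_J is
    reflexive as soon as no set of cardinality mu belongs to J^perp or to
    J^perp^perp.

    It therefore suffices to find two orthogonal families of countable sets such
    that every unbounded subset of mu contains a member of each.  A club guessing
    argument gives, for each d < mu of countable cofinality, a two-colouring of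
    the ordinals below d such that for every unbounded X there is d at which both
    colours are cofinal in X.  The two families consist of the monochromatic
    sequences of order type omega cofinal in some d, of each colour.  Finally
    |G_J| = mu because mu is regular and strong limit. *)

Set Implicit Arguments.
Unset Strict Implicit.
Unset Printing Implicit Defensive.

Import GRing.Theory Num.Theory.

Local Open Scope classical_set_scope.
Local Open Scope card_scope.
Local Open Scope ring_scope.

(** * Comparison of cardinals and initial orders *)

Lemma card_leTP (T U : Type) :
  [set: T] #<= [set: U] <-> exists f : T -> U, injective f.
Proof.
split=> [/card_leP[f]|[f finj]].
  exists (fun x => val (f (SigSub (mem_set (I : [set: T] x))))) => x y /val_inj.
  by move=> /(@inj _ _ _ f); rewrite !inE => /(_ I I) [].
have /injfunPex[g] : exists2 f : T -> U, set_fun setT setT f & set_inj setT f.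
  by exists f => // x y _ _; exact: finj.
exact: inj_card_le g.
Qed.

(** Zorn's lemma for sets of sections that pairwise differ at every index. A maximal one covers some
    [U i], as otherwise a section avoiding it everywhere could be added; following these sections
    embeds [U i] into each [U j]. *)
Lemma least_cardinal (I : Type) (i0 : I) (U : I -> Type) :
  exists i, forall j, [set: U i] #<= [set: U j].
Proof.
pose P (S : set (forall i, U i)) :=
  forall i s t, S s -> S t -> s i = t i -> s = t.
have [|A [PA Amax]] := @Zorn_bigcup _ P.
  move=> F FP Ftot i s t [X FX Xs] [Y FY Yt].
  by have [XY|YX] := Ftot _ _ FX FY;
    [apply: (FP _ FY) => //; apply: XY|apply: (FP _ FX) => //; apply: YX].
have [[i isurj]|nsurj] :=
    pselect (exists i, forall u : U i, exists2 s, A s & s i = u).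
  exists i => j; apply/card_leTP.
  have /choice[r rP] : forall u, exists s, A s /\ s i = u.
    by move=> u; have [s As su] := isurj u; exists s.
  exists (fun u => r u j) => u v ruv.
  have [[Au <-] [Av <-]] := (rP u, rP v).
  by rewrite (PA j _ _ Au Av ruv).
have /all_sig[s sP] : forall i, {u : U i | forall t, A t -> t i <> u}.
  move=> i; apply: cid; apply: contrapT => nu; apply: nsurj; exists i => u.
  apply: contrapT => nt; apply: nu; exists u => t At tu; apply: nt.
  by exists t.
exfalso; apply: (Amax (A `|` [set s])).
  split; first by move=> t; left.
  by move=> /(_ s (or_intror erefl)) /(sP i0).
move=> i t u [At|->] [Au|->] //; first exact: PA At Au.
  by move/(sP i _ At).
by move/esym/(sP i _ Au).
Qed.

Lemma card_le_total (T U : Type) :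
  [set: T] #<= [set: U] \/ [set: U] #<= [set: T].
Proof.
have [[] /= h] := @least_cardinal bool true (fun b => if b then T else U).
  by left; exact: (h false).
by right; exact: (h true).
Qed.

Record initial_order (T : Type) (lt : T -> T -> Prop) : Prop := InitialOrder {
  ini_irr : forall x, ~ lt x x;
  ini_tr : forall y x z, lt x y -> lt y z -> lt x z;
  ini_tot : forall x y, [\/ lt x y, x = y | lt y x];
  ini_min : forall P : set T, P !=set0 -> exists2 x, P x & forall y, P y -> ~ lt y x;
  ini_small : forall x, ~ ([set: T] #<= [set y | lt y x]) }.

Lemma exists_well_order (T : Type) : exists lt : T -> T -> Prop,
  [/\ forall x, ~ lt x x,
      forall y x z, lt x y -> lt y z -> lt x z,
      forall x y, [\/ lt x y, x = y | lt y x]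
    & forall P : set T, P !=set0 -> exists2 x, P x & forall y, P y -> ~ lt y x].
Proof.
elim/Peq: T => T.
have [R Rwo] := wochoice.well_ordering_principle T.
have Rwo' : @wochoice.wo_chain T R predT by move=> A _; exact: Rwo.
have Rtot := wochoice.wo_chainW Rwo'.
have Ranti := wochoice.wo_chain_antisymmetric Rwo'.
have Rmin (P : set T) : P !=set0 -> exists2 x, P x & forall y, P y -> R x y.
  move=> [x Px]; have [|z [[zP zmin] _]] := Rwo (mem P).
    by exists x; rewrite inE.
  by exists z; [rewrite inE in zP|move=> y Py; apply: zmin; rewrite inE].
have Rtr y x z : R x y -> R y z -> R x z.
  move=> xy yz.
  have [|w [-> wmin|-> wmin|-> wmin]] := Rmin [set w | [\/ w = x, w = y | w = z]].
  - by exists x; constructor 1.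
  - by apply: wmin; constructor 3.
  - have yx := wmin x (Or31 _ _ erefl).
    by rewrite (Ranti x y isT isT) // xy yx.
  - have zy := wmin y (Or32 _ _ erefl).
    by rewrite -(Ranti y z isT isT) // yz zy.
exists (fun x y => R x y /\ x <> y); split.
- by move=> x [].
- move=> y x z [xy nxy] [yz _]; split; first exact: Rtr yz.
  by move=> xz; apply: nxy; apply: Ranti; rewrite // xy xz yz.
- move=> x y; have [->|/eqP xy] := eqVneq x y; first by constructor 2.
  by have /orP[h|h] := Rtot x y isT isT; [constructor 1|constructor 3];
    split=> //; exact: nesym.
- move=> P /Rmin[x Px xmin]; exists x => // y Py [yx nyx].
  by apply: nyx; apply: Ranti; rewrite // yx xmin.
Qed.

(** If some segment of a well-order has full cardinality, the order is pulled back along an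
    injection into the segment below the least such point. *)
Lemma exists_initial_order (T : Type) :
  exists lt : T -> T -> Prop, initial_order lt.
Proof.
have [lt [irr tr tot mi]] := exists_well_order T.
have [[x0 hx0]|nx] :=
    pselect (exists x, [set: T] #<= [set y | lt y x]); last first.
  exists lt; split=> // x hx; apply: nx; by exists x.
have [x {}hx xmin] := mi _ (ex_intro _ x0 hx0 : [set x | _ #<= _] !=set0).
have /card_leTP[f finj] : [set: T] #<= [set: [set y | lt y x]].
  by apply: card_le_trans hx _; rewrite (card_le_eqr (card_setT _)).
exists (fun a b => lt (val (f a)) (val (f b))); split.
- by move=> a; exact: irr.
- by move=> b a c; exact: tr.
- move=> a b; have [h|h|h] := tot (val (f a)) (val (f b)).
  + by constructor 1.
  + by constructor 2; apply: finj; exact: val_inj.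
  + by constructor 3.
- move=> P [a Pa].
  have [|_ [b Pb <-] bmin] := mi ((fun a => val (f a)) @` P).
    by exists (val (f a)), a.
  by exists b => // c Pc; apply: bmin; exists c.
- move=> a ha; apply: (xmin (val (f a))); last exact: (set_mem (valP (f a))).
  apply: card_le_trans ha _.
  have : (fun b => val (f b)) @` [set b | lt (val (f b)) (val (f a))]
      `<=` [set y | lt y (val (f a))] by move=> _ [b ? <-].
  move=> /subset_card_le; apply: card_le_trans.
  suff /inj_card_eq/card_eqPle[] : {in [set b | lt (val (f b)) (val (f a))] &,
    injective (fun b => val (f b))} by [].
  by move=> b c _ _ /val_inj/finj.
Qed.

(** * From sigma-complete ultrafilters to measurable cardinals *)

Lemma ultrafilter_dichotomy (X : Type) (D : set_system X) :
  D setT -> ~ D set0 -> (forall A B, D A -> D B -> D (A `&` B)) ->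
  (forall A B, A `<=` B -> D A -> D B) -> (forall A, D A \/ D (~` A)) ->
  UltraFilter D.
Proof.
move=> DT D0 DI DS Dor.
have DF : ProperFilter D by split.
split=> // G GF DG; rewrite eqEsubset; split=> // A GA.
have [//|/DG GnA] := Dor A.
by have [x [Ax]] := filter_ex (filterI GA GnA).
Qed.

Lemma ultra_compl (X : Type) (D : set_system X) (A : set X) :
  UltraFilter D -> ~ D A -> D (~` A).
Proof. by move=> Du; have [] := in_ultra_setVsetC A Du. Qed.

(* Among the partitions of a D-large set into D-null pieces, take one with the
   least number of pieces: the image of D on the set of pieces is then complete
   with respect to its own cardinality. *)
Lemma sigma_complete_measurable (X : Type) (D : set_system X) :
  UltraFilter D ->
  (forall A : nat -> set X, (forall n, D (A n)) -> D (\bigcap_n A n)) ->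
  (forall x, ~ D [set x]) ->
  exists K : Type, measurable_cardinal K /\ [set: K] #<= [set: X].
Proof.
move=> Du Dsig Dnp.
have Df : Filter D by case: Du => -[].
have DS A B : D A -> A `<=` B -> D B by move=> DA AB; exact: filterS DA.
(* The pieces are the fibres of [q.2] over the labels in [q.1]. Labels are points of [X], so that
   all partitions range over one type. *)
pose good (q : set X * (X -> X)) :=
  D (q.2 @^-1` q.1) /\ forall t, ~ D (q.2 @^-1` [set t]).
have good0 : good (setT, id) by split=> //; exact: filterT.
have [[[T p] /= Tp] Tmin] := @least_cardinal {q | good q} (exist _ _ good0)
  (fun q => (sval q).1).
case: Tp Tmin => /= DT Dfib Tmin.
exists T; split; last by rewrite (card_le_eql (card_setT T)) card_leT.
pose F : set_system T := [set P | D [set x | exists2 k : T, P k & p x = val k]].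
have FE P x : [set x | exists2 k : T, P k & p x = val k] x ->
    forall k : T, p x = val k -> P k.
  by move=> [k Pk ->] l /val_inj <-.
have Dval x : T (p x) -> exists k : T, p x = val k.
  by move=> Tx; exists (SigSub (mem_set Tx)).
have Fu : UltraFilter F.
  apply: ultrafilter_dichotomy.
  - by apply: (DS _ _ DT) => x /Dval[k xk]; exists k.
  - by move=> h; have [x []] := @filter_ex _ D _ _ h.
  - move=> A B FA FB; apply: (DS _ _ (@filterI _ D _ _ _ FA FB)) => x [[k Ak xk] hB].
    by exists k => //; split=> //; exact: FE hB _ xk.
  - move=> A B AB FA; apply: (DS _ _ FA) => x [k Ak xk]; exists k => //; exact: AB.
  - move=> A; have [|/(@ultra_compl _ D) nA] := pselect (F A); first by left.
    right; apply: (DS _ _ (filterI nA DT)) => x [nAx /Dval[k xk]].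
    by exists k => // Ak; apply: nAx; exists k.
have Fnp k : ~ F [set k].
  by move=> h; apply: (Dfib (val k)); apply: (DS _ _ h) => x [_ -> xk].
split; last first.
  exists F; split=> //.
    by move=> k Fk; apply: (Fnp k); rewrite Fk; exact/principal_filterP.
  (* Relabelling the points of a large set by a member of [S] that their label misses gives null
     pieces, no more numerous than [S]: minimality of [T] applies. *)
  move=> S SF [SK nKS]; apply: contrapT => nFS; apply: nKS.
  have DN : D (~` [set x | exists2 k : T, (\bigcap_(A in S) A) k & p x = val k]
      `&` p @^-1` T) by apply: filterI => //; exact: ultra_compl.
  set N := (X in D X) in DN.
  have [j jinj] : exists j : S -> T, injective j.
    by apply/card_leTP; rewrite (card_le_eql (card_setT S)).
  have /choice[r rP] : forall x, exists o : option S, N x ->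
      exists P : S, exists k : T, [/\ o = Some P, p x = val k & ~ val P k].
    move=> x; have [[nx /Dval[k xk]]|] := pselect (N x); last by exists None.
    have [P [SP nPk]] : exists P : set T, S P /\ ~ P k.
      apply: contrapT => nP; apply: nx; exists k => // P SP.
      by apply: contrapT => nPk; apply: nP; exists P.
    by exists (Some (SigSub (mem_set SP))) => _; exists (SigSub (mem_set SP)), k.
  pose s x := if r x is Some P then val (j P) else x.
  pose T' := range (fun P => val (j P)).
  have gs : good (T', s).
    split=> /=.
      by apply: (DS _ _ DN) => x /rP[P [k [rx _ _]]]; exists P; rewrite // /s rx.
    move=> t /(filterI DN) h; have [x [/rP[P [k [rx xk nPk]]]]] := filter_ex h.
    rewrite /preimage /= /s rx => Pt.
    have FP : F (val P) by apply: SF; exact: (set_mem (valP P)).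
    have [y [[/rP[Q [l [ry yl nQl]]]] + [m Pm ym]]] := filter_ex (filterI h FP).
    rewrite /preimage /= /s ry -Pt => /val_inj/jinj QP; apply: nQl; rewrite QP.
    by suff -> : l = m by []; apply: val_inj; rewrite -yl -ym.
  have := Tmin (exist _ _ gs); rewrite /= => /card_le_trans; apply.
  rewrite (card_le_eql (card_setT T')).
  apply: card_le_trans (card_image_le _ _) _.
  by rewrite (card_le_eql (card_setT S)).
(* Were [T] countable, sigma-completeness would give a large set disjoint from all pieces. *)
move=> /card_leTP[e einj].
pose A n := ~` [set x | exists2 k : T, e k = n & p x = val k].
have DA n : D (A n).
  apply: ultra_compl => h; have [x [k kn xk]] := filter_ex h.
  apply: (Dfib (val k)); apply: (DS _ _ h) => y [l ln yl].
  by rewrite /preimage /= yl; congr val; apply: einj; rewrite ln.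
have [x [Ax /Dval[k xk]]] := filter_ex (filterI (Dsig A DA) DT).
by apply: (Ax (e k)) => //; exists k.
Qed.

(** * Homomorphisms from a power of the integers *)

Lemma uncountable_cantor : ~ countable [set: nat -> bool].
Proof.
move=> /card_leTP[F Finj].
pose d n := `[< exists2 e, F e = n & ~~ e n >].
have [dF|dF] := boolP (d (F d)); last first.
  by move/asboolP: (dF); apply; exists d.
by have /asboolP[e /Finj ->] := dF; rewrite dF.
Qed.

Definition delta (X : Type) (x : X) (n : int) : X -> int :=
  fun z => if `[< z = x >] then n else 0.

Lemma deltaxx (X : Type) (x : X) n : delta x n x = n.
Proof. by rewrite /delta asboolT. Qed.

Lemma deltaNx (X : Type) (x z : X) n : z <> x -> delta x n z = 0.
Proof. by move=> zx; rewrite /delta asboolF. Qed.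

(** Nested form of the sum of [e_i b_k ... b_(i-1) f_i(x)] over the [m] indices [i] starting at
    [k]. *)
Fixpoint horner_sum (X : Type) (b : nat -> nat) (e : nat -> bool)
    (f : nat -> X -> int) (x : X) (m k : nat) : int :=
  if m is m'.+1 then f k x *+ e k + horner_sum b e f x m' k.+1 *+ b k else 0.

(* With b_k > |psi (f_k)|, the value of psi at
   sum_k e_k b_0 ... b_(k-1) f_k determines the bits e_k, which is absurd
   since there are uncountably many sequences of bits. *)
Lemma slender (X : Type) (psi : {additive (X -> int) -> int})
    (f : nat -> X -> int) (N : X -> nat) :
  (forall x n, (N x <= n)%N -> f n x = 0) -> exists n, psi (f n) = 0.
Proof.
move=> fN; apply: contrapT => nz.
have {}nz n : psi (f n) <> 0 by move=> h; apply: nz; exists n.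
pose b k := `|psi (f k)|%N.+1.
pose u e k : X -> int := fun x => horner_sum b e f x (N x - k) k.
have uE e k : u e k = f k *+ e k + u e k.+1 *+ b k.
  apply/funext => x; rewrite fctE !natmulfctE /u.
  have [Nk|kN] := leqP (N x) k; last by rewrite -(subnSK kN).
  rewrite fN //; have -> : (N x - k = 0)%N by lia.
  have -> : (N x - k.+1 = 0)%N by lia.
  by rewrite /= !mul0rn addr0.
have psiu e k : psi (u e k) = psi (f k) *+ e k + psi (u e k.+1) *+ b k.
  by rewrite uE raddfD !raddfMn.
(* The difference of [a *+ c] and [a *+ d] is a multiple of [|a| + 1] of absolute value at most
   [|a|], hence zero. *)
have bits (a p q : int) (c d : bool) : a <> 0 ->
    a *+ c + p *+ `|a|.+1 = a *+ d + q *+ `|a|.+1 -> c = d /\ p = q.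
  move=> a0; have [B BE] : exists B, B = `|a|.+1 by eexists.
  have aB : (`|a| < B)%N by rewrite BE.
  rewrite -{}BE.
  rewrite !pmulrn !mulrzz => e.
  have {}e : a * (c%:Z - d%:Z) = (q - p) * B%:Z by rewrite mulrBr mulrBl; lia.
  have qp : `|q - p|%N = 0%N.
    move: (congr1 absz e); rewrite !abszM /=.
    have : (`|c%:Z - d%:Z| <= 1)%N by case: c {e}; case: d.
    move=> /(leq_mul (leqnn `|a|)); rewrite muln1 => le1 eq1.
    move: eq1; case: `|q - p|%N => // j; rewrite mulSn => eq1.
    by have := leq_addr (j * B) B; rewrite -eq1 => /leq_trans/(_ le1); lia.
  have {}qp : q = p by lia.
  by split=> //; move: e; rewrite qp subrr mul0r; case: c; case: d => //=; lia.
have step e e' k : psi (u e k) = psi (u e' k) ->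
    e k = e' k /\ psi (u e k.+1) = psi (u e' k.+1).
  by rewrite (psiu e) (psiu e' k); apply: bits.
apply: uncountable_cantor.
have : countable [set: int] by [].
apply: card_le_trans; apply/card_leTP; exists (fun e => psi (u e 0%N)).
move=> e e' h; apply/funext => k.
suff h' j : psi (u e j) = psi (u e' j) by have [] := step _ _ _ (h' k).
by elim: j => // j /step[].
Qed.

Section Los.
Variables (X : Type) (psi : {additive (X -> int) -> int}).

(** The [delta] functions at infinitely many distinct points would form a sequence eventually zero
    at each point, against [slender]. *)
Lemma finite_delta_support : finite_set [set x | psi (delta x 1) <> 0].
Proof.
apply: contrapT => /infiniteP; set A := (X in _ #<= X).
rewrite -(card_le_eqr (card_setT A)) => /card_leTP[a ainj].
have /choice[N hN] : forall x, exists N, forall n, (N <= n)%N ->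
    delta (val (a n)) 1 x = 0.
  move=> x; have [[m mx]|nx] := pselect (exists m, val (a m) = x).
    exists m.+1 => n mn; apply: deltaNx; rewrite -mx => /val_inj/ainj nm.
    by rewrite nm ltnn in mn.
  by exists 0%N => n _; apply: deltaNx => xn; apply: nx; exists n.
have [n] := slender psi hN.
exact: (set_mem (valP (a n))).
Qed.

Definition null (B : set X) :=
  forall g : X -> int, (forall x, ~ B x -> g x = 0) -> psi g = 0.

Lemma null_sub A B : A `<=` B -> null B -> null A.
Proof. by move=> AB nB g gA; apply: nB => x nBx; apply: gA => /AB. Qed.

(** Erasing [g] on the sets [B k] one at a time leaves [psi] unchanged, and by [slender] some
    truncation is sent to 0. *)
Lemma null_bigcup (B : nat -> set X) :
  (forall n, null (B n)) -> null (\bigcup_n B n).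
Proof.
move=> nB g gB.
pose f n : X -> int := fun x => if `[< exists2 k, (k < n)%N & B k x >] then 0 else g x.
have [x|N hN] := @choice _ _ (fun x N => forall n, (N <= n)%N -> f n x = 0).
  have [[k _ Bk]|nBx] := pselect ((\bigcup_n B n) x).
    by exists k.+1 => n kn; rewrite /f asboolT //; exists k.
  by exists 0%N => n _; rewrite /f gB //; case: ifP.
have [n <-] := slender psi hN.
elim: n => [|n ->]; first by
  congr (psi _); apply/funext => x; rewrite /f asboolF // => -[].
apply/eqP; rewrite -subr_eq0 -raddfB; apply/eqP; apply: (nB n) => x nBx.
rewrite !fctE /f.
suff -> : `[< exists2 k, (k < n.+1)%N & B k x >] = `[< exists2 k, (k < n)%N & B k x >].
  by rewrite subrr.
apply: asbool_equiv_eq; split=> -[k kn Bk]; exists k => //; last exact: ltnW.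
move: kn; rewrite ltnS leq_eqVlt => /orP[/eqP kn|//].
by rewrite kn in Bk.
Qed.

Lemma null0 : null set0.
Proof.
move=> g g0; have -> : g = 0 by apply/funext => x; exact: g0.
by rewrite raddf0.
Qed.

Lemma null_setU A B : null A -> null B -> null (A `|` B).
Proof.
move=> nA nB; apply: (@null_sub _ (\bigcup_n if n is 0%N then A else B)).
  by move=> x [Ax|Bx]; [exists 0%N|exists 1%N].
by apply: null_bigcup => -[].
Qed.

(** Witnesses of non-nullity on disjoint sets would form a sequence eventually zero at each point,
    against [slender]. *)
Lemma nonnull_overlap (B : nat -> set X) : (forall n, ~ null (B n)) ->
  exists x n m, [/\ B n x, B m x & n <> m].
Proof.
move=> nB; apply: contrapT => dB.
have Bdisj x n m : B n x -> B m x -> n = m.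
  by move=> Bn Bm; apply: contrapT => nm; apply: dB; exists x, n, m.
have [n|f hf] := @choice _ _ (fun n (g : X -> int) =>
    (forall x, ~ B n x -> g x = 0) /\ psi g <> 0).
  apply: contrapT => h; apply: (nB n) => g gB.
  by apply: contrapT => gn; apply: h; exists g.
have [x|N hN] := @choice _ _ (fun x N => forall n, (N <= n)%N -> f n x = 0).
  have [[m Bm]|nx] := pselect (exists m, B m x).
    exists m.+1 => n mn; apply: (hf n).1 => Bn.
    by rewrite (Bdisj _ _ _ Bm Bn) ltnn in mn.
  by exists 0%N => n _; apply: (hf n).1 => Bn; apply: nx; exists n.
by have [n] := slender psi hN; exact: (hf n).2.
Qed.

(** Without an atom, repeated splitting would cut off infinitely many disjoint non-null pieces. *)
Lemma exists_atom : ~ null setT ->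
  exists2 C, ~ null C & forall A, null (C `&` A) \/ null (C `\` A).
Proof.
move=> nT; apply: contrapT => natom.
have [C|s hs] := @choice _ _ (fun C A => ~ null C ->
    ~ null (C `&` A) /\ ~ null (C `\` A)).
  apply: contrapT => h; apply: natom; exists C.
    by move=> nC; apply: h; exists setT.
  move=> A; apply: contrapT => hA; apply: h; exists A => _.
  by split=> nA; apply: hA; [left|right].
pose C := fix C n := if n is m.+1 then C m `\` s (C m) else setT.
have nC n : ~ null (C n) by elim: n => [//|n /hs[]].
have Cdecr n m : (n <= m)%N -> C m `<=` C n.
  move=> /subnKC <-; elim: (m - n)%N => [|k ih]; first by rewrite addn0.
  by rewrite addnS => x [/ih].
have [n|x [n [m [[Cn sn] [Cm sm] nm]]]] :=
    @nonnull_overlap (fun n => C n `&` s (C n)).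
  exact: (hs _ (nC n)).1.
wlog nm' : n m Cn sn Cm sm nm / (n < m)%N.
  move=> h; have [/h|/h|] := ltngtP n m; [by apply|by apply=> //; exact: nesym|by []].
by have /= [_ []] : C n.+1 x by exact: Cdecr Cm.
Qed.

(* If psi is nonzero, the ideal of null sets has an atom, hence X carries a
   sigma-complete ultrafilter, nonprincipal because points are null. *)
Theorem Los : (forall K : Type, measurable_cardinal K -> ~ ([set: K] #<= [set: X])) ->
  (forall x, psi (delta x 1) = 0) -> forall g, psi g = 0.
Proof.
move=> Xsmall psi0.
have null1 x : null [set x].
  move=> g gx; have gE : g = delta x (g x).
    apply/funext => z; have [->|zx] := pselect (z = x); first by rewrite deltaxx.
    by rewrite deltaNx // gx.
  have nat_case n : psi (delta x n%:Z) = 0.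
    have -> : delta x n%:Z = delta x 1 *+ n.
      apply/funext => z; rewrite natmulfctE /delta.
      case: ifP => _; last by rewrite mul0rn.
      by rewrite -[RHS]/(1%:R *+ n) -mulr_natr mul1r natz.
    by rewrite raddfMn psi0 mul0rn.
  rewrite gE; case: (g x) => n; first exact: nat_case.
  rewrite NegzE.
  have -> : delta x (- n.+1%:Z) = - delta x n.+1%:Z.
    by apply/funext => z; rewrite fctE /delta; case: ifP => _ //; rewrite oppr0.
  by rewrite raddfN nat_case oppr0.
suff nT : null setT by move=> g; apply: nT => x [].
apply: contrapT => /exists_atom[C nC Cat].
pose D : set_system X := [set A | null (C `\` A)].
have [] := @sigma_complete_measurable X D.
- apply: ultrafilter_dichotomy.
  + by apply: null_sub null0 => x [_ []].
  + by move=> h; apply: nC; apply: null_sub h => x Cx; split.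
  + move=> A B DA DB; apply: null_sub (null_setU DA DB) => x [Cx nAB].
    have [Ax|nAx] := pselect (A x); last by left.
    by right; split=> // Bx; apply: nAB.
  + by move=> A B AB; apply: null_sub => x [Cx nBx]; split=> // /AB.
  + move=> A; have [h|h] := Cat A; last by left.
    by right; apply: null_sub h => x [Cx]; rewrite /= /setC => /contrapT.
- move=> A DA; apply: null_sub (null_bigcup DA) => x [Cx nAx].
  apply: contrapT => h; apply: nAx => n _; apply: contrapT => nAn.
  by apply: h; exists n.
- move=> x Dx; apply: nC; apply: null_sub (null_setU (null1 x) Dx) => z Cz.
  by have [zx|nzx] := pselect (z = x); [left|right].
by move=> K [/Xsmall].
Qed.

End Los.

(** * Groups of functions with support in an orthogonal family *)

Definition perp (M : Type) (J : set (set M)) : set (set M) :=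
  [set B | forall A, J A -> finite_set (A `&` B)].

Section Perp.
Variables (M : Type).
Implicit Types (J : set (set M)) (A B : set M).

Lemma perp_sub J A B : A `<=` B -> perp J B -> perp J A.
Proof.
move=> AB JB C /JB; apply: sub_finite_set => x [Cx /AB Bx]; by split.
Qed.

Lemma perp_setU J A B : perp J A -> perp J B -> perp J (A `|` B).
Proof. by move=> JA JB C JC; rewrite setIUr finite_setU; split; auto. Qed.

Lemma perp_finite J A : finite_set A -> perp J A.
Proof. by move=> fA C _; exact: finite_setIr. Qed.

Lemma sub_perp2 J : J `<=` perp (perp J).
Proof. by move=> A JA B /(_ _ JA); rewrite setIC. Qed.

Lemma perp3 J : perp (perp (perp J)) = perp J.
Proof.
apply/seteqP; split; last exact: sub_perp2.
by move=> A h B /sub_perp2; exact: h.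
Qed.

Definition supp (f : M -> int) : set M := [set x | f x <> 0].

Definition perp_group J : {pred M -> int} := fun f => `[< perp J (supp f) >].

Lemma perp_groupP J f : reflect (perp J (supp f)) (f \in perp_group J).
Proof. exact: asboolP. Qed.

Lemma perp_group_zmod_closed J : zmod_closed (perp_group J).
Proof.
split=> [|f g /perp_groupP hf /perp_groupP hg]; apply/perp_groupP.
  by apply: perp_finite; apply: sub_finite_set (finite_set0 M) => x [].
apply: perp_sub (perp_setU hf hg) => x; rewrite /supp /= !fctE => fg.
have [f0|] := eqVneq (f x) 0; [right=> g0|by left; exact/eqP].
by apply: fg; rewrite f0 g0 subrr.
Qed.

HB.instance Definition _ J :=
  GRing.isZmodClosed.Build (M -> int) (perp_group J) (perp_group_zmod_closed J).

End Perp.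

Section Pairing.
Variables (M : choiceType).
Implicit Types (f g y : M -> int).

(** By convention the sum is 0 when infinitely many terms are nonzero, so additivity requires
    finiteness of the common supports. *)
Definition pair f y : int := \sum_(x \in [set: M]) f x * y x.

Lemma pair_fset (A : {fset M}) f y :
  supp f `&` supp y `<=` [set` A] -> pair f y = \sum_(x <- A) f x * y x.
Proof.
move=> hA; rewrite /pair (fsbigTE A) // => x xA.
apply/eqP; rewrite mulf_eq0; apply/norP => -[/eqP fx /eqP yx].
by move: xA; rewrite (hA x).
Qed.

Lemma pairC f y : pair f y = pair y f.
Proof. by rewrite /pair; under eq_fsbigr do rewrite mulrC. Qed.

Lemma pairB f g y : finite_set (supp f `&` supp y) ->
  finite_set (supp g `&` supp y) -> pair (f - g) y = pair f y - pair g y.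
Proof.
move=> ff fg; have : finite_set ((supp f `|` supp g) `&` supp y).
  by rewrite setIUl finite_setU.
move=> /finite_fsetP[A hA].
rewrite (@pair_fset A f) ?(@pair_fset A g) ?(@pair_fset A (f - g)) -?hA.
- by rewrite -sumrB; apply: eq_bigr => x _; rewrite !fctE mulrBl.
- move=> x [fgx yx]; split=> //; rewrite /supp /= in fgx *.
  have [f0|] := eqVneq (f x) 0; [right=> g0|by left; exact/eqP].
  by apply: fgx; rewrite !fctE f0 g0 subrr.
- by move=> x [? ?]; split=> //; right.
- by move=> x [? ?]; split=> //; left.
Qed.

Lemma pair_delta x y : pair (delta x 1) y = y x.
Proof.
rewrite (@pair_fset [fset x]%fset) ?big_seq_fset1 ?deltaxx ?mul1r // => z [hz _].
rewrite /= inE; apply/eqP; apply: contrapT => zx.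
by apply: hz; rewrite deltaNx.
Qed.

End Pairing.

Section Dual.
Variables (M : choiceType) (J : set (set M)).
Hypothesis Jsmall : forall A, perp J A ->
  forall K : Type, measurable_cardinal K -> ~ ([set: K] #<= A).

Notation G := (subgroup_type (perp_group J)).
Variable phi : G -> int.
Hypothesis phiB : zmod_morphism phi.

(** Total, with default value 0 off the group, so that no membership proof has to be carried. *)
Definition in_group (f : M -> int) : G := insubd (0 : G) f.

Lemma val_in_group f : perp J (supp f) -> val (in_group f) = f.
Proof. by move=> /perp_groupP hf; rewrite /in_group insubdK. Qed.

Lemma supp_delta (x : M) n : supp (delta x n) `<=` [set x].
Proof. by move=> z hz; apply: contrapT => zx; apply: hz; rewrite deltaNx. Qed.

Definition coef (x : M) : int := phi (in_group (delta x 1)).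

Definition extend (A : set M) (g : A -> int) : M -> int :=
  fun x => if insub x is Some a then g a else 0.

Lemma extend_val (A : set M) (g : A -> int) (a : A) : extend g (val a) = g a.
Proof. by rewrite /extend valK. Qed.

Lemma extendN (A : set M) (g : A -> int) x : ~ A x -> extend g x = 0.
Proof. by move=> nAx; rewrite /extend insubN //; apply/negP => /set_mem. Qed.

Lemma supp_extend (A : set M) (g : A -> int) : supp (extend g) `<=` A.
Proof. by move=> x hx; apply: contrapT => nAx; apply: hx; exact: extendN. Qed.

Lemma extendB (A : set M) (g h : A -> int) : extend (g - h) = extend g - extend h.
Proof.
by apply/funext => x; rewrite !fctE /extend; case: insubP => *; rewrite ?subrr.
Qed.

Lemma extend_delta (A : set M) (a : A) n : extend (delta a n) = delta (val a) n.
Proof.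
apply/funext => x; have [Ax|nAx] := pselect (A x).
  pose b : A := SigSub (mem_set Ax); have -> : x = val b by [].
  rewrite extend_val; have [->|ba] := pselect (b = a); first by rewrite !deltaxx.
  by rewrite !deltaNx // => /val_inj.
rewrite extendN // deltaNx // => xa; apply: nAx; rewrite xa.
exact: (set_mem (valP a)).
Qed.

Lemma in_groupB f g : perp J (supp f) -> perp J (supp g) ->
  in_group (f - g) = in_group f - in_group g.
Proof.
move=> hf hg; apply: val_inj; rewrite raddfB /= !val_in_group //.
by apply/perp_groupP/rpredB; exact/perp_groupP.
Qed.

(** The functions supported in [A] form a copy of the power of the integers indexed by [A], to which
    [Los] applies. *)
Lemma dual_on (A : set M) : perp J A -> finite_set (A `&` supp coef) /\
  forall f : G, supp (val f) `<=` A -> phi f = pair (val f) coef.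
Proof.
move=> JA.
have Jext g : perp J (supp (@extend A g)) by exact: perp_sub (@supp_extend A g) JA.
pose psi g := phi (in_group (@extend A g)).
have psiB : zmod_morphism psi.
  by move=> g h; rewrite /psi extendB in_groupB // phiB.
pose psiM : {additive (A -> int) -> int} :=
  HB.pack psi (GRing.isZmodMorphism.Build _ _ psi psiB).
have fin : finite_set (A `&` supp coef).
  have := finite_image val (finite_delta_support psiM).
  apply: sub_finite_set => x [Ax cx]; exists (SigSub (mem_set Ax)) => //.
  by rewrite /= /psi extend_delta.
split=> // f fA.
(* Subtracting the pairing kills every [delta], so by [Los] the difference is zero. *)
pose psi2 g := psi g - pair (@extend A g) coef.
have psi2B : zmod_morphism psi2.
  move=> g h; rewrite /psi2 psiB extendB pairB; first by rewrite !opprD !opprK addrACA.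
    by apply: sub_finite_set fin => x [/supp_extend].
  by apply: sub_finite_set fin => x [/supp_extend].
pose psi2M : {additive (A -> int) -> int} :=
  HB.pack psi2 (GRing.isZmodMorphism.Build _ _ psi2 psi2B).
have := @Los A psi2M _ _ (fun a => val f (val a)).
have extf : extend (fun a : A => val f (val a)) = val f.
  apply/funext => x; have [Ax|nAx] := pselect (A x).
    by have -> : x = val (SigSub (mem_set Ax) : A) by []; rewrite extend_val.
  by rewrite extendN //; apply/esym; apply: contrapT => /fA.
rewrite /= /psi2 /psi extf => /(_ _ _)/eqP; rewrite subr_eq0 => h.
rewrite -(eqP (h _ _)).
- by congr phi; apply: val_inj; rewrite val_in_group //; exact: perp_sub fA JA.
- move=> K Kmeas; rewrite (card_le_eqr (card_setT A)); exact: Jsmall.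
- by move=> a; rewrite extend_delta pair_delta subrr.
Qed.

Lemma perp_coef : perp (perp J) (supp coef).
Proof. by move=> A /dual_on[]. Qed.

Lemma dual_pair f : phi f = pair (val f) coef.
Proof. by have [_] := dual_on (elimT (perp_groupP _ _) (valP f)); apply. Qed.

End Dual.

Section Reflexive.
Variables (M : choiceType) (J : set (set M)).
Hypothesis Jsmall : forall A, perp J A ->
  forall K : Type, measurable_cardinal K -> ~ ([set: K] #<= A).
Hypothesis Jsmall2 : forall A, perp (perp J) A ->
  forall K : Type, measurable_cardinal K -> ~ ([set: K] #<= A).

Notation G := (subgroup_type (perp_group J)).
Notation H := (subgroup_type (perp_group (perp J))).

Lemma pair_finite (f : G) (y : H) : finite_set (supp (val f) `&` supp (val y)).
Proof.
have /perp_groupP hf := valP f; have /perp_groupP hy := valP y.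
exact: hy hf.
Qed.

Fact pairl_zmod_morphism (y : H) : zmod_morphism (fun f : G => pair (val f) (val y)).
Proof. by move=> f g; rewrite raddfB pairB //; exact: pair_finite. Qed.

Definition pairing (y : H) : dual G :=
  HB.pack (fun f : G => pair (val f) (val y))
    (GRing.isZmodMorphism.Build _ _ _ (pairl_zmod_morphism y)).

Lemma pairingB : zmod_morphism pairing.
Proof.
move=> y z; apply: dual_ext => f; rewrite /= pairC pairB.
- by rewrite !(pairC (sval f)).
- by rewrite setIC; exact: pair_finite.
- by rewrite setIC; exact: pair_finite.
Qed.

(** Pairing with [delta x 1] reads off the coordinate at [x], whence injectivity. For surjectivity,
    [F \o pairing] is a functional on [H], hence the pairing with some [z], which lies in [G] by
    [perp3]; and every element of the dual of [G] is a [pairing]. *)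
Theorem perp_group_reflexive : reflexive_group G.
Proof.
have inj : injective (@double_dual_map G).
  move=> f g fg; apply: val_inj; apply/funext => x.
  have px : perp (perp J) (supp (delta x 1)).
    by apply: perp_finite; apply: sub_finite_set (finite_set1 x); exact: supp_delta.
  have := congr1 (fun F : dual (dual G) =>
    F (pairing (in_group (perp J) (delta x 1)))) fg.
  by rewrite /= /dual_eval /= val_in_group // ![pair (val _) _]pairC !pair_delta.
have surj (F : dual (dual G)) : exists z : G, double_dual_map z = F.
  have FB : zmod_morphism (F \o pairing) by move=> y z; rewrite /= pairingB raddfB.
  pose z := coef (F \o pairing).
  have zG : perp J (supp z) by rewrite -perp3; exact: perp_coef.
  exists (in_group J z); apply: dual_ext => phi.
  have phiB : zmod_morphism phi by exact: raddfB.
  have -> : phi = pairing (in_group (perp J) (coef phi)).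
    apply: dual_ext => f; rewrite /= val_in_group; last exact: perp_coef.
    exact: dual_pair.
  set y := in_group (perp J) _.
  have := dual_pair Jsmall2 FB y; rewrite /= => ->.
  by rewrite /dual_eval /= val_in_group // pairC.
have [g gK] := choice surj.
by exists g => // f; apply: inj; exact: gK.
Qed.

End Reflexive.

(** * Smallness below a measurable cardinal *)

Lemma min_well_founded (T : Type) (R : T -> T -> Prop) :
  (forall P : set T, P !=set0 -> exists2 x, P x & forall y, P y -> ~ R y x) ->
  well_founded R.
Proof.
move=> Rmin x; apply: contrapT => nx.
have [y ny ymin] := Rmin [set z | ~ Acc R z] (ex_intro _ x nx).
by apply: ny; constructor => z zy; apply: contrapT => /ymin.
Qed.

(** Recursion along [R] gives each point a value not taken earlier; one remains since no segment
    maps onto [U]. *)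
Lemma small_segments_card_le (T U : Type) (R : T -> T -> Prop) :
  well_founded R -> (forall x y, [\/ R x y, x = y | R y x]) ->
  (forall x, ~ ([set: U] #<= [set y | R y x])) -> [set: T] #<= [set: U].
Proof.
move=> Rwf Rtot Rsmall.
have fresh x (e : forall y, R y x -> U) : {u | forall y (yx : R y x), e y yx <> u}.
  apply: cid; apply: contrapT => h; apply: (Rsmall x).
  have /choice[g hg] : forall u, exists y : [set y | R y x], exists yx, e (val y) yx = u.
    move=> u; apply: contrapT => nu; apply: h; exists u => y yx eu.
    by apply: nu; exists (SigSub (mem_set (yx : [set z | R z x] y))), yx.
  rewrite -(card_le_eqr (card_setT [set y | R y x])).
  apply/card_leTP; exists g => u v guv.
  have [[p <-] [q <-]] := (hg u, hg v).
  by move: p q; rewrite guv => p q; rewrite (Prop_irrelevance p q).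
pose e := Fix Rwf (fun _ => U) (fun x e => sval (fresh x e)).
have eE x : e x = sval (fresh x (fun y _ => e y)).
  rewrite /e Fix_eq // => y g h gh; congr (sval (fresh _ _)).
  by apply: functional_extensionality_dep => z; apply/funext => zy; exact: gh.
have eR x y : R y x -> e y <> e x.
  by move=> yx; rewrite (eE x); exact: (svalP (fresh x (fun y _ => e y)) y yx).
apply/card_leTP; exists e => x y exy.
by have [/eR|//|/eR] := Rtot x y => h; [case: h|case: h].
Qed.

Section Measurable.
Variables (M : Type) (F : set_system M).
Hypothesis Mnc : ~ countable [set: M].
Hypothesis Fu : UltraFilter F.
Hypothesis Fnp : forall x, F <> principal_filter x.
Hypothesis Fcomp : card_complete F.
Variable lt : M -> M -> Prop.
Hypothesis lto : initial_order lt.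

Definition small (T : Type) := ~ ([set: M] #<= [set: T]).

Let Ff : Filter F. Proof. by case: Fu => -[]. Qed.

Lemma small_card_le (T U : Type) : [set: T] #<= [set: U] -> small U -> small T.
Proof. by move=> TU sU MT; apply: sU; exact: card_le_trans MT TU. Qed.

Lemma small_inj (T U : Type) (f : T -> U) : injective f -> small U -> small T.
Proof. by move=> finj; apply: small_card_le; apply/card_leTP; exists f. Qed.

Lemma small_countable (T : Type) : countable [set: T] -> small T.
Proof. by move=> Tc MT; apply: Mnc; exact: card_le_trans MT Tc. Qed.

Lemma small_bigcap (I : Type) (A : I -> set M) : small I ->
  (forall i, F (A i)) -> F (\bigcap_i A i).
Proof.
move=> sI FA; have RI : range A #<= [set: I] by exact: card_image_le.
have := @Fcomp (range A); rewrite bigcap_image; apply.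
  by move=> _ [i _ <-].
split; last by move=> MR; apply: sI; exact: card_le_trans RI.
have [IM|//] := card_le_total I M.
exact: card_le_trans RI IM.
Qed.

Lemma not_large_set1 x : ~ F [set x].
Proof.
move=> Fx; apply: (Fnp (x := x)).
have pu := principal_filter_ultra x.
by apply: max_filter => A /principal_filterP Ax; apply: filterS Fx => _ ->.
Qed.

Lemma small_large_compl (A : set M) : small A -> F (~` A).
Proof.
move=> sA; have := @small_bigcap A (fun a => ~` [set val a]) sA.
have h (a : A) : F (~` [set val a]) by apply: ultra_compl => //; exact: not_large_set1.
move=> /(_ h); apply: filterS => x hx Ax.
exact: (hx (SigSub (mem_set Ax)) I).
Qed.

(** This is the strong limit property. Given an injection [g], each coordinate of [g x] is constant
    on a large set; intersecting over [K] makes [g] constant on a large set, which is then a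
    singleton. *)
Lemma small_arrow (K V : Type) : small K -> small V -> small (K -> V).
Proof.
move=> sK sV /card_leTP[g ginj].
have /choice[v hv] : forall i, exists v, F [set x | g x i = v].
  move=> i; apply: contrapT => nv.
  have := @small_bigcap V (fun v => ~` [set x | g x i = v]) sV.
  have h v : F (~` [set x | g x i = v]).
    by apply: ultra_compl => // Fv; apply: nv; exists v.
  by move=> /(_ h) /filter_ex[x hx]; exact: hx (g x i) I erefl.
have Fv := small_bigcap sK hv.
have [x hx] := filter_ex Fv.
apply: (@not_large_set1 x); apply: filterS Fv => y hy.
by apply: ginj; apply/funext => i; rewrite (hy i I) (hx i I).
Qed.

Lemma small_seg x : small [set y | lt y x].
Proof. by rewrite /small (card_le_eqr (card_setT _)); exact: ini_small. Qed.

(** Regularity: the points above [f i] form a large set, and a small intersection of large sets is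
    nonempty. *)
Lemma small_bounded (K : Type) (f : K -> M) : small K ->
  exists b, forall i, lt (f i) b.
Proof.
move=> sK; apply: contrapT => nb.
have h i : F (~` [set y | lt y (f i)] `&` ~` [set f i]).
  apply: filterI; first by apply: small_large_compl; exact: small_seg.
  by apply: ultra_compl => //; exact: not_large_set1.
have [x hx] := filter_ex (small_bigcap sK h); apply: nb; exists x => i.
have [hl hn] := hx i I.
by have [//|xf|/hl//] := ini_tot lto (f i) x; case: hn.
Qed.

Definition bounded (A : set M) := exists b, forall x, A x -> lt x b.

Lemma unbounded_gt (A : set M) : ~ bounded A -> forall b, exists2 x, A x & lt b x.
Proof.
move=> nA b; have [c bc] : exists c, unit -> lt b c.
  by apply: small_bounded; apply: small_countable; exact: countableP.
apply: contrapT => h; apply: nA; exists c => x Ax.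
have [xb|->|bx] := ini_tot lto x b; [|exact: bc|].
  by apply: ini_tr xb _ => //; exact: bc.
by exfalso; apply: h; exists x.
Qed.

Lemma bounded_small (A : set M) : bounded A -> small A.
Proof.
move=> [b Ab]; apply: small_card_le (@small_seg b).
rewrite (card_le_eqr (card_setT _)) (card_le_eql (card_setT _)).
exact: subset_card_le.
Qed.

(** Functions are well-ordered by a bound of their support, then arbitrarily. Those preceding [f]
    are determined on the segment below [rk f], so they are few by [small_arrow]. *)
Lemma card_le_bounded_support :
  [set f | bounded (supp f)] #<= [set: M].
Proof.
set S := [set f | _].
rewrite -(card_le_eql (card_setT S)).
have /choice[rk hrk] : forall f : S, exists b, forall x, supp (val f) x -> lt x b.
  by move=> f; exact: (set_mem (valP f)).
have [W [Wirr Wtr Wtot Wmin]] := exists_well_order S.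
pose R f g := lt (rk f) (rk g) \/ rk f = rk g /\ W f g.
apply: (@small_segments_card_le _ _ R).
- apply: min_well_founded => P [f Pf].
  have [|b [g [Pg gb]] bmin] := ini_min lto (P := [set b | exists g, P g /\ rk g = b]).
    by exists (rk f), f.
  have [|h [Ph hb] hmin] := Wmin [set g | P g /\ rk g = b]; first by exists g.
  exists h => // k Pk [|[kh]]; first by rewrite hb; apply: bmin; exists k.
  by apply: hmin; split=> //; rewrite kh.
- move=> f g; have [fg|fg|gf] := ini_tot lto (rk f) (rk g).
  + by constructor 1; left.
  + have [h|->|h] := Wtot f g; [constructor 1|constructor 2|constructor 3] => //.
      by right.
    by right.
  + by constructor 3; left.
- move=> f; rewrite -(card_le_eqr (card_setT [set g | R g f])).
  apply: (@small_inj _ ([set y | lt y (rk f)] -> int)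
    (fun g y => val (val g) (val y))); last first.
    by apply: small_arrow; [exact: small_seg|apply: small_countable; exact: countableP].
  move=> g h gh; apply: val_inj; apply: val_inj; apply/funext => x.
  have [xf|nxf] := pselect (lt x (rk f)).
    by have := congr1 (fun u => u (SigSub (mem_set (xf : [set y | lt y (rk f)] x)))) gh.
  have out (k : [set g | R g f]) : val (val k) x = 0%R.
    apply: contrapT => /hrk xk; apply: nxf.
    by case: (set_mem (valP k)) => [kf|[<-] //]; apply: ini_tr kf.
  by rewrite !out.
Qed.

End Measurable.

(** * Club guessing and orthogonal families *)

(** Indices for the closure of a family of sets under an operation with countably many arguments. *)
Inductive ctree := leaf | node of (nat -> ctree).

Fixpoint ctree_nodes (t : ctree) (s : seq nat) : bool :=
  if t is node f then if s is n :: s' then ctree_nodes (f n) s' else true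
  else false.

(** Coding a tree by the addresses of its nodes bounds the number of trees by the continuum. *)
Lemma ctree_nodes_inj : injective ctree_nodes.
Proof.
elim=> [|f ih] [|g] // fg; try by move/(congr1 (@^~ [::])): fg.
congr node; apply/funext => n; apply: ih; apply/funext => s.
by move/(congr1 (@^~ (n :: s))): fg.
Qed.

Section ClubGuessing.
Variables (M : Type) (lt : M -> M -> Prop).
Hypothesis lto : initial_order lt.
Implicit Types (X E S : set M) (a b d x y z : M).

Let lt_trans y x z : lt x y -> lt y z -> lt x z := @ini_tr _ _ lto y x z.

Lemma le_lt_trans y x z : ~ lt y x -> lt y z -> lt x z.
Proof. by move=> yx yz; have [/lt_trans/(_ yz)|->|] := ini_tot lto x y. Qed.

Lemma lt_le_trans y x z : lt x y -> ~ lt z y -> lt x z.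
Proof. by move=> xy zy; have [/(lt_trans xy)|<-|] := ini_tot lto y z. Qed.

(* Vacuously true at the least element d of M. *)
Definition limit_of X d := forall c, lt c d -> exists x, [/\ X x, lt c x & lt x d].

Definition cofinal_seq d (c : nat -> M) :=
  (forall n, lt (c n) d) /\ forall b, lt b d -> exists n, lt b (c n).

Definition omega_limit d := exists c, cofinal_seq d c.

(** Each new term is chosen in [X] above the previous one and not below the corresponding term of a
    sequence cofinal in [d]. *)
Lemma increasing_in X d : omega_limit d -> limit_of X d ->
  exists g : nat -> M, [/\ forall n, X (g n), forall n, lt (g n) (g n.+1) &
    cofinal_seq d g].
Proof.
move=> [c [cd ccof]] Xd.
have /choice[nx hnx] : forall p : M * nat, exists x, lt p.1 d ->
    [/\ X x, lt p.1 x, ~ lt x (c p.2) & lt x d].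
  move=> [y n] /=; have [yd|] := pselect (lt y d); last by exists y.
  have [ycn|ycn] := pselect (lt y (c n)).
    have [x [Xx cx xd]] := Xd _ (cd n); exists x => _; split=> //.
      exact: lt_trans cx.
    by move=> /(lt_trans cx)/(ini_irr lto).
  have [x [Xx yx xd]] := Xd _ yd; exists x => _; split=> // xcn.
  by apply: ycn; exact: lt_trans xcn.
pose g := fix g n := if n is m.+1 then nx (g m, m) else nx (c 0, 0)%N.
have gd n : lt (g n) d.
  by elim: n => [|n ih]; [have [] := hnx (c 0, 0)%N (cd 0%N)|have [] := hnx (g n, n) ih].
exists g; split.
- by case=> [|n]; [have [] := hnx (c 0, 0)%N (cd 0%N)|have [] := hnx (g n, n) (gd n)].
- by move=> n; have [] := hnx (g n, n) (gd n).
- split=> // b /ccof[n bc]; exists n.+1.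
  by have [_ _ h _] := hnx (g n, n) (gd n); exact: lt_le_trans h.
Qed.

Lemma increasing_lt (g : nat -> M) : (forall n, lt (g n) (g n.+1)) ->
  forall m n, (m < n)%N -> lt (g m) (g n).
Proof.
move=> gS m; elim=> // n ih; rewrite ltnS leq_eqVlt => /orP[/eqP ->//|/ih h].
exact: lt_trans (gS n).
Qed.

(* Colour a point by the parity of its interval between consecutive terms of
   the sequence: every limit point d_n is preceded by elements of X lying in
   the interval that ends at d_n. *)
Lemma interval_colouring d (s : nat -> M) : cofinal_seq d s ->
  exists h : M -> bool, forall X, (forall n, limit_of X (s n)) ->
    forall b : bool, limit_of [set x | X x /\ h x = b] d.
Proof.
move=> sd; have [|g [gs gS [gd gcof]]] := @increasing_in (range s) d (ex_intro _ s sd).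
  by move=> c /sd.2[n cn]; exists (s n); split=> //; exact: sd.1.
have gmono := increasing_lt gS.
(* The interval containing [x] is numbered by its right end [g n]. *)
pose col x n := lt x (g n) /\ forall k, (k < n)%N -> ~ lt x (g k).
exists (fun x => `[< exists2 n, col x n & odd n >]) => X Xs b c /gcof[n0 cn0].
have hcol x n : col x n -> `[< exists2 n, col x n & odd n >] = odd n.
  move=> [xn xk]; apply/asboolP/idP => [[m [xm xl]]|on]; last by exists n.
  by have [/xk//|/xl//|->] := ltngtP m n.
have [m [oddm cgm]] : exists m, odd m.+1 = b /\ lt c (g m).
  have [<-|nb] := eqVneq (odd n0) b.
    by exists n0.+1; rewrite /= negbK; split=> //; exact: lt_trans (gS n0).
  by exists n0; split=> //=; case: (odd n0) nb; case: b.
have [k _ sk] := gs m.+1.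
have [|x [Xx mx xm]] := Xs k (g m); first by rewrite sk.
rewrite sk in xm; exists x; split; last exact: lt_trans xm (gd _).
  split=> //; rewrite -oddm; apply: hcol; split=> // j jm xj.
  have {jm} : ~ lt (g m) (g j).
    move: jm; rewrite ltnS leq_eqVlt => /orP[/eqP ->|/gmono jm /(lt_trans jm)];
      by move/(ini_irr lto).
  by apply; exact: lt_trans xj.
exact: lt_trans mx.
Qed.

(** Says that [b] is the supremum of the elements of [E] up to [a]; this exists for every [E], being
    the least element of [M] if there are none. *)
Definition last_before_spec E a b :=
  (forall e, E e -> lt b e -> lt a e) /\
  forall c, lt c b -> exists e, [/\ E e, lt c e & ~ lt a e].

Lemma exists_last_before E a : exists b, last_before_spec E a b.
Proof.
have [|b bE bmin] := ini_min lto (P := [set b | forall e, E e -> lt b e -> lt a e]).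
  by exists a => e.
exists b; split=> // c cb; apply: contrapT => nc; apply: (bmin c) => // e Ee ce.
by apply: contrapT => ae; apply: nc; exists e.
Qed.

(* For closed E meeting [0, a] this is the largest element of E up to a. *)
Definition last_before E a := projT1 (cid (exists_last_before E a)).

Lemma last_beforeP E a : last_before_spec E a (last_before E a).
Proof. exact: projT2. Qed.

Lemma last_before_le E a : ~ lt a (last_before E a).
Proof.
by move=> /(last_beforeP E a).2[e [_ ae]].
Qed.

Lemma last_before_ge E a e : E e -> ~ lt a e -> ~ lt (last_before E a) e.
Proof. by move=> Ee ae /((last_beforeP E a).1 _ Ee). Qed.

Lemma last_before_sub E E' a : E' `<=` E -> ~ lt (last_before E a) (last_before E' a).
Proof.
move=> EE' /(last_beforeP E' a).2[e [/EE' Ee he ae]].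
exact: last_before_ge he.
Qed.

Definition common_limits (K : Type) (Y : K -> set M) : set M :=
  [set d | forall k, limit_of (Y k) d].

(** The set of common limits is closed under suprema, and contains the least element of [M]
    vacuously. *)
Lemma last_before_common (K : Type) (Y : K -> set M) a :
  common_limits Y (last_before (common_limits Y) a).
Proof.
set E := common_limits Y; move=> k c cb.
have [e [Ee ce ae]] := (last_beforeP E a).2 _ cb.
have [x [Yx cx xe]] := Ee k c ce.
by exists x; split=> //; apply: lt_le_trans xe (last_before_ge Ee ae).
Qed.

Hypothesis bounded_nat : forall f : nat -> M, exists b, forall n, lt (f n) b.

(** Iterate from [c] a step that jumps over an element of every [Y k]; the supremum of the iterates
    is as required. *)
Lemma exists_common_limit (K : Type) (Y : K -> set M) :
  (forall f : K -> M, exists b, forall k, lt (f k) b) ->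
  (forall k b, exists2 x, Y k x & lt b x) ->
  forall c, exists d, [/\ lt c d, omega_limit d & common_limits Y d].
Proof.
move=> Kb Yunb c.
have /choice[nx hnx] : forall b, exists b', lt b b' /\
    forall k, exists x, [/\ Y k x, lt b x & lt x b'].
  move=> b; have /choice[x hx] : forall k, exists x, Y k x /\ lt b x.
    by move=> k; have [x] := Yunb k b; exists x.
  have [b1 hb1] := Kb x.
  have [b2 hb2] := bounded_nat (fun n => if n is 0%N then b else b1).
  exists b2; split; first exact: (hb2 0%N).
  move=> k; exists (x k); have [Yx bx] := hx k; split=> //.
  exact: lt_trans (hb1 k) (hb2 1%N).
pose g n := iter n nx c.
have gS n : lt (g n) (g n.+1) by exact: (hnx _).1.
have [|d dub dmin] := ini_min lto (P := [set d | forall n, lt (g n) d]).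
  exact: bounded_nat.
have gcof b : lt b d -> exists n, lt b (g n).
  move=> bd; apply: contrapT => nb; apply: (dmin b) => // n.
  by apply: lt_le_trans (gS n) _ => h; apply: nb; exists n.+1.
exists d; split; first exact: (dub 0%N); first by exists g.
move=> k b /gcof[n bn]; have [x [Yx nx_x xn]] := (hnx (g n)).2 k.
exists x; split=> //; first exact: lt_trans nx_x.
exact: lt_trans xn (dub n.+1).
Qed.

Hypothesis bounded_ctree : forall f : ctree -> M, exists b, forall t, lt (f t) b.

(* Club guessing at points of countable cofinality.  If no colouring works, feed
   each countable family of sets to a counterexample w, and close under w: this
   gives sets indexed by countably branching trees.  At a common limit d, the
   values [last_before] along a ladder of d reach their minimum on a countable
   subfamily, so they do not change when its own counterexample is added. *)
Lemma exists_colouring (d0 : M) : exists h : M -> M -> bool,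
  forall X, (forall b, exists2 x, X x & lt b x) ->
  exists2 d, omega_limit d & forall c, limit_of [set x | X x /\ h d x = c] d.
Proof.
have /choice[lad hlad] : forall d, exists c, omega_limit d -> cofinal_seq d c.
  move=> d; have [[c hc]|nd] := pselect (omega_limit d); first by exists c.
  by exists (fun _ => d).
have /choice[col hcol] : forall p : M * (nat -> M), exists h : M -> bool,
    cofinal_seq p.1 p.2 -> forall X, (forall n, limit_of X (p.2 n)) ->
    forall b : bool, limit_of [set x | X x /\ h x = b] p.1.
  move=> [d s] /=; have [/interval_colouring[h hh]|] := pselect (cofinal_seq d s).
    by exists h.
  by exists (fun _ => true).
(* The ladder of [d], pushed down into the closed set of common limits of [Y]. *)
pose ladder (Y : nat -> set M) d n := last_before (common_limits Y) (lad d n).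
apply: contrapT => ncol.
have /choice[w hw] : forall Y : nat -> set M, exists X,
    (forall b, exists2 x, X x & lt b x) /\ forall d, omega_limit d ->
    ~ forall c, limit_of [set x | X x /\ col (d, ladder Y d) x = c] d.
  move=> Y; apply: contrapT => nX; apply: ncol; exists (fun d => col (d, ladder Y d)).
  move=> X Xunb; apply: contrapT => nd; apply: nX; exists X; split=> // d dlim hd.
  by apply: nd; exists d.
pose X := fix X t := if t is node f then w (fun n => X (f n)) else [set: M].
have Xunb t b : exists2 x, X t x & lt b x.
  case: t => [|f] /=; last exact: (hw _).1.
  by have [x /(_ 0%N) bx] := bounded_nat (fun _ => b); exists x.
have allunb b : exists2 d, common_limits X d & lt b d.
  by have [d []] := exists_common_limit bounded_ctree Xunb b; exists d.
(* A limit of common limits of the whole family: the ladders of its subfamilies stay cofinal in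
   [d]. *)
have [d [_ dlim Ed]] := @exists_common_limit unit (fun _ => common_limits X)
  (fun f => let: ex_intro b hb := bounded_nat (fun _ => f tt) in
    ex_intro _ b (fun u => let: tt := u in hb 0%N)) (fun _ => allunb) d0.
have {}Ed := Ed tt.
have [ladd ladcof] := hlad _ dlim.
pose fam (f : nat -> ctree) n := X (f n).
pose val_at f n := last_before (common_limits (fam f)) (lad d n).
have /choice[fm hfm] : forall n, exists f, forall f', ~ lt (val_at f' n) (val_at f n).
  move=> n; have [|_ [f _ <-] fmin] := ini_min lto (P := range (val_at ^~ n)).
    by exists (val_at (fun _ => leaf) n), (fun _ => leaf).
  by exists f => f'; apply: fmin; exists f'.
(* A coding of pairs merges the minimising families into one that attains every minimum at once. *)
pose f k := if choice.unpickle k is Some p then fm p.1 p.2 else leaf.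
(* Index 0 adds the counterexample to the family [f] itself. The ladder, already minimal, cannot
   move, so its points are limits of that counterexample. *)
pose f' k := if k is k'.+1 then f k' else node f.
have fsub n : common_limits (fam f) `<=` common_limits (fam (fm n)).
  by move=> e fe k; have := fe (choice.pickle (n, k)); rewrite /fam /f choice.pickleK.
have f'sub : common_limits (fam f') `<=` common_limits (fam f).
  by move=> e fe k; exact: (fe k.+1).
have valE n : val_at f n = val_at f' n.
  have [h|//|h] := ini_tot lto (val_at f n) (val_at f' n).
    by case: (last_before_sub f'sub h).
  case: (hfm n f'); apply: lt_le_trans h _; exact: last_before_sub.
have lad_lim n : limit_of (X (node f)) (ladder (fam f) d n).
  rewrite -[ladder _ _ _]/(val_at f n) valE.
  exact: (@last_before_common _ (fam f') (lad d n) 0%N).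
have ladder_cof : cofinal_seq d (ladder (fam f) d).
  split=> [n|b /Ed[e [Ee be /ladcof[n en]]]].
    exact: le_lt_trans (@last_before_le _ _) (ladd n).
  exists n; apply: lt_le_trans be _; apply: last_before_ge.
    by move=> k; exact: Ee.
  by move=> /(lt_trans en); move/(ini_irr lto).
apply: ((hw (fam f)).2 d dlim).
exact: (hcol (d, ladder (fam f) d) ladder_cof (X (node f)) lad_lim).
Qed.

Definition coloured_sequences (h : M -> M -> bool) (c : bool) : set (set M) :=
  [set A | exists d g, [/\ A = range g, cofinal_seq d g,
    forall n, lt (g n) (g n.+1) & forall n, h d (g n) = c]].

Lemma coloured_sequence_infinite h c A : coloured_sequences h c A -> infinite_set A.
Proof.
move=> [d [g [-> _ gS _]]]; apply/infiniteP.
have gmono := increasing_lt gS.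
have /inj_card_eq/card_eqPle[] : {in [set: nat] &, injective g}; last by [].
move=> m n _ _ gmn; have [/gmono|/gmono|//] := ltngtP m n;
  by rewrite gmn => /(ini_irr lto).
Qed.

(** All terms of [g], but only finitely many terms of [g'], lie below [d]. *)
Lemma finite_cofinal_cap d d' (g g' : nat -> M) : lt d d' ->
  cofinal_seq d g -> cofinal_seq d' g' -> (forall n, lt (g' n) (g' n.+1)) ->
  finite_set (range g `&` range g').
Proof.
move=> dd' [gd _] [_ gcof'] /increasing_lt g'mono.
have [n dn] := gcof' _ dd'.
apply: sub_finite_set (finite_image g' (finite_II n.+1)) => _ [[m _ <-] [k _ kE]].
exists k => //=; rewrite ltnNge; apply/negP => nk.
apply: (ini_irr lto (x := d)); apply: lt_trans dn _; apply: lt_trans (g'mono _ _ nk) _.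
by rewrite kE.
Qed.

Lemma coloured_sequences_perp h :
  coloured_sequences h false `<=` perp (coloured_sequences h true).
Proof.
move=> _ [d' [g' [-> cof' gS' h']]] _ [d [g [-> cof gS hd]]].
have [dd'|dd'|d'd] := ini_tot lto d d'; first exact: finite_cofinal_cap dd' _ _ _.
  apply: sub_finite_set (finite_set0 M) => _ [[m _ <-] [k _ kE]].
  by have := hd m; rewrite dd' -kE h'.
by rewrite setIC; exact: finite_cofinal_cap d'd _ _ _.
Qed.

(** An unbounded [X] contains infinite sequences of both colours: one in [J] keeps it out of
    [perp J], one in [perp J] keeps it out of [perp (perp J)]. *)
Lemma exists_perp_family (d0 : M) : exists J : set (set M),
  forall X, (forall b, exists2 x, X x & lt b x) -> ~ perp J X /\ ~ perp (perp J) X.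
Proof.
have [h hh] := exists_colouring d0; exists (coloured_sequences h true).
move=> X /hh[d dlim hd].
have sub c : exists2 A, coloured_sequences h c A & A `<=` X.
  have [g [gX gS gcof]] := increasing_in dlim (hd c).
  exists (range g); last by move=> _ [n _ <-]; exact: (gX n).1.
  by exists d, g; split=> // n; exact: (gX n).2.
split=> [XJ|XJ].
  have [A Ac AX] := sub true; apply: (coloured_sequence_infinite Ac).
  by apply: sub_finite_set (XJ _ Ac) => x Ax; split=> //; exact: AX.
have [A Ac AX] := sub false; apply: (coloured_sequence_infinite Ac).
apply: sub_finite_set (XJ _ (coloured_sequences_perp Ac)) => x Ax.
by split=> //; exact: AX.
Qed.

End ClubGuessing.

Theorem theorem1p1 (M : Type) (hM : first_measurable_cardinal M) :
  exists G : zmodClosed (M -> int),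
    reflexive_group (subgroup_type G) /\ [set` G] #= [set: M].
Proof.
(* [M] is given a choice structure, which the finitely supported sums of [pair] require. *)
elim/Pchoice: M hM => M [[Mnc [F [Fu Fnp Fcomp]]] Mleast].
have [lt lto] := exists_initial_order M.
have sM : forall K : Type, countable [set: K] -> small M K.
  by move=> K; exact: small_countable.
have bnd K (f : K -> M) : small M K -> exists b, forall k, lt (f k) b.
  exact: (small_bounded Fu Fnp Fcomp lto).
have [d0 _] : [set: M] !=set0.
  by apply/set0P/negP => /eqP M0; apply: Mnc; rewrite M0; exact: countable0.
have small_ctree : small M ctree.
  apply: (small_inj ctree_nodes_inj).
  by apply: (small_arrow Fu Fnp Fcomp); apply: sM; exact: countableP.
have [|f|J hJ] := @exists_perp_family M lt lto _ _ d0.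
- by move=> f; apply: bnd; apply: sM; exact: countableP.
- exact: bnd.
have unb := unbounded_gt Mnc Fu Fnp Fcomp lto.
have Jb A : perp J A -> bounded lt A.
  by move=> JA; apply: contrapT => /unb/hJ[/(_ JA)].
have J2b A : perp (perp J) A -> bounded lt A.
  by move=> JA; apply: contrapT => /unb/hJ[_ /(_ JA)].
(* Here the leastness of [M] enters: a measurable [K] inside [A] would make [A] as large as [M]. *)
have sb A : bounded lt A -> forall K : Type, measurable_cardinal K -> ~ ([set: K] #<= A).
  move=> /(bounded_small lto) sA K /Mleast MK KA; apply: sA.
  by rewrite (card_le_eqr (card_setT A)); exact: card_le_trans MK KA.
pose G : zmodClosed (M -> int) := perp_group J.
exists G; split.
  by apply: perp_group_reflexive => A; [move/Jb/sb|move/J2b/sb].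
apply/card_eqPle; split.
  apply: card_le_trans (card_le_bounded_support Mnc Fu Fnp Fcomp lto).
  by apply: subset_card_le => f /perp_groupP/Jb.
(* The lower bound on the cardinality comes from the functions [delta x 1], whose supports are
   finite. *)
have dinj : {in [set: M] &, injective (fun x : M => delta x 1)}.
  move=> x y _ _ /(congr1 (@^~ x)); rewrite deltaxx /delta.
  by case: asboolP.
have /card_eqPle[_ /card_le_trans] := inj_card_eq dinj; apply.
apply: subset_card_le => _ [x _ <-] /=; apply/perp_groupP; apply: perp_finite.
by apply: sub_finite_set (finite_set1 x); exact: supp_delta.
Qed.
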